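(* Let $f:X\to Y$ be a function between topological spaces. Then: (i) $f$ is sequentially proper if and only if $f$ is sequentially continuous and $f^{-1}(V)\in\varepsilon_{sc}(X)$ for all $V\in\varepsilon_{sc}(Y)$. (ii) Suppose that $X$ is $\omega$-sequential. Then $f$ is proper if and only if $f$ is sequentially proper.
   Context: No separation axioms are assumed. A proper map is a continuous map $f:X\to Y$ such that $f^{-1}(K)$ is closed compact for every closed compact $K\subset Y$. A proper sequence in $X$ is a sequence $s:\mathbb{N}\to X$ such that $s^{-1}(K)$ is finite for every closed compact $K\subset X$. A function $f:X\to Y$ is sequentially continuous if $s\to x$ in $X$ implies $f\circ s\to f(x)$ in $Y$; it is sequentially proper if it is sequentially continuous and $f\circ s$ is a proper sequence in $Y$ for every proper sequence $s$ in $X$. A subset $U\subset X$ is sequentially open if every sequence converging to a point of $U$ is eventually in $U$; a subset is sequentially closed if its complement is sequentially open; $X$ is sequential if every sequentially open subset is open. A subset $C\subset X$ is s-compact if it is sequentially closed and every proper sequence in $X$ is eventually in $X\setminus C$. $\varepsilon_{sc}(X)=\{U\subset X : X\setminus U \text{ is s-compact}\}$. $X$ is $\omega$-sequential if it is sequential and its s-compact subsets are exactly its closed compact subsets. *)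

(* Defs.v *)
From mathcomp Require Import all_boot all_order all_classical all_analysis.

Set Implicit Arguments.
Unset Strict Implicit.
Unset Printing Implicit Defensive.

Local Open Scope classical_set_scope.

Definition proper_map (X Y : topologicalType) (f : X -> Y) : Prop :=
  continuous f /\
  forall K : set Y, closed K -> compact K ->
    closed (f @^-1` K) /\ compact (f @^-1` K).

Definition proper_seq (X : topologicalType) (s : nat -> X) : Prop :=
  forall K : set X, closed K -> compact K -> finite_set (s @^-1` K).

(* No separation axiom is assumed, so a sequence may converge to several
   points; [s @ \oo --> x] only says that [x] is one of its limits. *)
Definition seq_continuous (X Y : topologicalType) (f : X -> Y) : Prop :=
  forall (s : nat -> X) (x : X), s @ \oo --> x -> (f \o s) @ \oo --> f x.

Definition seq_proper (X Y : topologicalType) (f : X -> Y) : Prop :=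
  seq_continuous f /\
  forall s : nat -> X, proper_seq s -> proper_seq (f \o s).

Definition seq_open (X : topologicalType) (U : set X) : Prop :=
  forall (s : nat -> X) (x : X), U x -> s @ \oo --> x ->
    \forall n \near \oo, U (s n).

Definition seq_closed (X : topologicalType) (C : set X) : Prop :=
  seq_open (~` C).

Definition sequential_space (X : topologicalType) : Prop :=
  forall U : set X, seq_open U -> open U.

Definition s_compact (X : topologicalType) (C : set X) : Prop :=
  seq_closed C /\
  forall s : nat -> X, proper_seq s -> \forall n \near \oo, (~` C) (s n).

Definition epsilon_sc (X : topologicalType) : set (set X) :=
  [set U | s_compact (~` U)].
Arguments epsilon_sc : clear implicits.

Definition omega_sequential (X : topologicalType) : Prop :=
  sequential_space X /\
  forall C : set X, s_compact C <-> (closed C /\ compact C).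

(* Main.v *)
Require Import Defs.
From mathcomp Require Import all_boot all_order all_classical all_analysis.

(** Everything rests on one remark: [s @^-1` C] is finite exactly when the
    sequence [s] is eventually outside [C] ([finite_preimage_near]).  A proper
    sequence is therefore one that eventually leaves every closed compact
    subset; as closed subsets are sequentially closed, every closed compact
    subset is s-compact ([closed_compact_s_compact]).

    For (i), preimages of s-compact subsets under a sequentially proper map are
    s-compact because the map carries convergent sequences to convergent ones
    and proper sequences to proper ones.  Conversely, if preimages of s-compact
    subsets are s-compact, a closed compact [K] in [Y] is s-compact, so a proper
    sequence of [X] eventually leaves [f @^-1` K], that is, its image
    eventually leaves [K].

    For (ii), a proper map is continuous, hence sequentially continuous, and
    [(f \o s) @^-1` K = s @^-1` (f @^-1` K)] is finite for [s] proper and [K]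
    closed compact.  Conversely, when [X] is sequential, sequential continuity
    is continuity; and (i) shows that the preimage of a closed compact subset
    is s-compact, which in an omega-sequential space means closed and compact. *)

Local Open Scope classical_set_scope.

Lemma finite_preimage_near (T : Type) (s : nat -> T) (C : set T) :
  finite_set (s @^-1` C) <-> \forall n \near \oo, (~` C) (s n).
Proof.
split=> [/finite_seqP[r rE] | [N _ sN]].
- exists (\max_(i <- r) i).+1 => // n /= r_lt_n Csn.
  have: n \in r by have: (s @^-1` C) n by []; rewrite rE.
  move=> nr; have := @leq_bigmax_seq _ r xpredT id n nr isT.
  by rewrite leqNgt r_lt_n.
- apply: (sub_finite_set _ (finite_II N)) => n /= Csn.
  by rewrite ltnNge; apply/negP => /sN.
Qed.

Lemma open_seq_open (X : topologicalType) (U : set X) : open U -> seq_open U.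
Proof. by move=> oU s x Ux; apply; exact: open_nbhs_nbhs. Qed.

Lemma closed_compact_s_compact (X : topologicalType) (K : set X) :
  closed K -> compact K -> s_compact K.
Proof.
move=> clK cK; split; first exact/open_seq_open/closed_openC.
by move=> s sP; apply/finite_preimage_near; exact: sP.
Qed.

Lemma seq_continuous_seq_open (X Y : topologicalType) (f : X -> Y)
    (U : set Y) :
  seq_continuous f -> seq_open U -> seq_open (f @^-1` U).
Proof. by move=> fc oU s x Ufx sx; exact: oU Ufx (fc s x sx). Qed.

Lemma continuous_seq_continuous (X Y : topologicalType) (f : X -> Y) :
  continuous f -> seq_continuous f.
Proof. by move=> fc s x sx; apply: cvg_comp sx _; exact: fc. Qed.

Lemma sequential_seq_continuous (X Y : topologicalType) (f : X -> Y) :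
  sequential_space X -> seq_continuous f -> continuous f.
Proof.
move=> Xseq fc; apply/continuousP => U oU.
exact/Xseq/seq_continuous_seq_open/open_seq_open.
Qed.

(** Since [s] is eventually outside [f @^-1` C] exactly when [f \o s] is
    eventually outside [C], it is enough that [f \o s] be proper when [s] is. *)
Lemma seq_proper_s_compact (X Y : topologicalType) (f : X -> Y) (C : set Y) :
  seq_proper f -> s_compact C -> s_compact (f @^-1` C).
Proof.
move=> [fc fp] [Ccl Cesc]; split.
  by rewrite /seq_closed preimage_setC; exact: seq_continuous_seq_open.
by move=> s sP; exact: Cesc (fp s sP).
Qed.

(** Only closed compact [C] have to be tested, and these are s-compact. *)
Lemma s_compact_seq_proper (X Y : topologicalType) (f : X -> Y) :
  seq_continuous f ->
  (forall C : set Y, s_compact C -> s_compact (f @^-1` C)) -> seq_proper f.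
Proof.
move=> fc fsc; split=> // s sP K clK cK.
have [_ esc] := fsc K (closed_compact_s_compact _ _ clK cK).
by apply/finite_preimage_near; exact: esc.
Qed.

Lemma proper_map_seq_proper (X Y : topologicalType) (f : X -> Y) :
  proper_map f -> seq_proper f.
Proof.
move=> [fc fp]; split; first exact: continuous_seq_continuous.
by move=> s sP K clK cK; have [] := fp K clK cK; exact: sP.
Qed.

Lemma seq_proper_proper_map (X Y : topologicalType) (f : X -> Y) :
  omega_sequential X -> seq_proper f -> proper_map f.
Proof.
move=> [Xseq Xsc] fp; split; first exact: sequential_seq_continuous fp.1.
move=> K clK cK; apply/Xsc.
exact/(seq_proper_s_compact _ _ _ _ fp)/closed_compact_s_compact.
Qed.

Theorem proposition3p6 (X Y : topologicalType) (f : X -> Y) :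
  (seq_proper f <->
     (seq_continuous f /\
      forall V : set Y, epsilon_sc Y V -> epsilon_sc X (f @^-1` V))) /\
  (omega_sequential X -> (proper_map f <-> seq_proper f)).
Proof.
split; last first.
  move=> Xom; split; [exact: proper_map_seq_proper|].
  exact: seq_proper_proper_map.
split=> [fp | [fc fsc]].
  by split=> [|V]; [exact: fp.1 | exact: seq_proper_s_compact].
apply: s_compact_seq_proper => // C Csc.
have := fsc (~` C); rewrite /epsilon_sc /= preimage_setC !setCK.
exact.
Qed.
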